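(* Let $R'$ be a semilocal commutative $\mathbb{Z}[\rho]$-algebra with structure map $f:\mathbb{Z}[\rho]\to R'$, and let $S'/R'$ be a $C_p$ Galois extension. Then there is a ring homomorphism $h: R\to R'$ extending $f$ such that $S'\cong T\otimes_{R,h}R'$ as $C_p$ Galois extensions of $R'$.
   Context: $p$ is a prime, $C_p=\langle\sigma\rangle$ is the cyclic group of order $p$, $\rho$ is a primitive $p$-th root of one, $\mathbb{Z}[\rho]=\mathbb{Z}[X]/(X^{p-1}+\cdots+1)$, and $\eta=\rho-1$. There is a unit $\xi\in\mathbb{Z}[\rho]^*$ with $p=\xi\eta^{p-1}$. Put $b_i=\binom{p}{i}/p$ for $1\le i\le p-1$ and $g(Z)=\xi\sum_{i=1}^{p-1} b_i\eta^{i-1}Z^i\in\mathbb{Z}[\rho][Z]$. Let $R=\mathbb{Z}[\rho][u][1/(1+u\eta^p)]$ ($u$ an indeterminate) and $T=R[Z]/(Z^p+g(Z)-u)$; $T/R$ is a $C_p$ Galois extension with $\sigma(\theta)=\rho\theta+1$, where $\theta$ is the image of $Z$. ''Galois'' is in the sense of Galois extensions of commutative rings; isomorphisms of $C_p$ Galois extensions are algebra isomorphisms over the base commuting with the $C_p$-actions. *)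

(* Defs.v *)
From HB Require Import structures.
From mathcomp Require Import all_boot all_order all_algebra.
From mathcomp Require Import boolp.

Set Implicit Arguments.
Unset Strict Implicit.
Unset Printing Implicit Defensive.

Import GRing.Theory.
Local Open Scope ring_scope.
Local Open Scope quotient_scope.

(* General rings are comPzRingType, so that the zero ring is not excluded. *)

Section Semilocal.
Variable A : comPzRingType.

Definition is_ideal (I : A -> Prop) : Prop :=
  [/\ I 0, forall x y, I x -> I y -> I (x + y) & forall a x, I x -> I (a * x)].

Definition maximal_ideal (I : A -> Prop) : Prop :=
  [/\ is_ideal I, ~ I 1 &
      forall J : A -> Prop, is_ideal J -> ~ J 1 ->
        (forall x, I x -> J x) -> forall x, J x -> I x].

Definition semilocal : Prop :=
  exists (n : nat) (m : 'I_n -> A -> Prop),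
    forall I : A -> Prop, maximal_ideal I ->
      exists i, forall x, I x <-> m i x.

End Semilocal.

(* An action of C_p = <sigma> on the R-algebra (S, iota) is given by the
   automorphism by which the generator sigma acts.  The last clause is the
   condition of Chase-Harrison-Rosenberg: there are x_j, y_j in S with
   \sum_j x_j tau(y_j) = 1 if tau = 1, and 0 for the other tau in C_p. *)
Record Cp_galois (p : nat) (R S : comPzRingType) (iota : {rmorphism R -> S})
    (sigma : {rmorphism S -> S}) : Prop := CpGalois {
  Cp_action : forall x, iter p sigma x = x;
  Cp_linear : forall r, sigma (iota r) = iota r;
  Cp_injective : injective iota;
  Cp_fixed : forall x, sigma x = x -> exists r, x = iota r;
  Cp_separable : exists xy : seq (S * S), forall k, (k < p)%N ->
    \sum_(z <- xy) z.1 * iter k sigma z.2 = (k == 0%N)%:R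
}.

Definition Cp_isomorphic (R S S' : comPzRingType)
    (iota : R -> S) (sigma : S -> S) (iota' : R -> S') (sigma' : S' -> S') :
    Prop :=
  exists Phi : {rmorphism S -> S'},
    [/\ bijective Phi, forall r, Phi (iota r) = iota' r &
        forall s, Phi (sigma s) = sigma' (Phi s)].

(* The tensor product A (x)_R B of commutative R-algebras.  Its elements are
   formal sums of pairs (x, y), represented by sequences; two formal sums are
   identified when every R-balanced biadditive map takes the same value on
   them.  The universal property is tensor_balanced, tensor_span and
   tensor_lift below. *)
Section Tensor.
Variables (R A B : comPzRingType).
Variables (alpha : {rmorphism R -> A}) (beta : {rmorphism R -> B}).

Definition balanced (M : zmodType) (phi : A -> B -> M) : Prop :=
  [/\ forall x x' y, phi (x + x') y = phi x y + phi x' y,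
      forall x y y', phi x (y + y') = phi x y + phi x y' &
      forall r x y, phi (alpha r * x) y = phi x (beta r * y)].

Definition tensor_eval (M : zmodType) (phi : A -> B -> M) (s : seq (A * B)) : M :=
  \sum_(z <- s) phi z.1 z.2.

Definition tensor_rel (s t : seq (A * B)) : bool :=
  `[< forall (M : zmodType) (phi : A -> B -> M),
        balanced phi -> tensor_eval phi s = tensor_eval phi t >].

Lemma tensor_relP s t :
  reflect (forall (M : zmodType) (phi : A -> B -> M),
             balanced phi -> tensor_eval phi s = tensor_eval phi t)
          (tensor_rel s t).
Proof. exact: asboolP. Qed.

Lemma tensor_rel_equiv : equiv_class_of tensor_rel.
Proof.
split=> [s|s t|t s u].
- by apply/tensor_relP.
- by apply/tensor_relP/tensor_relP=> H M phi b; rewrite H.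
- by move=> /tensor_relP H /tensor_relP K; apply/tensor_relP=> M phi b; rewrite H ?K.
Qed.

Canonical tensor_rel_equivRel := EquivRelPack tensor_rel_equiv.
Canonical tensor_rel_encModRel := defaultEncModRel tensor_rel.

Definition tensor : Type := {eq_quot tensor_rel}.

HB.instance Definition _ : EqQuotient (seq (A * B)) tensor_rel tensor :=
  EqQuotient.on tensor.
HB.instance Definition _ := Choice.on tensor.

Lemma tensor_eqP s t :
  reflect (forall (M : zmodType) (phi : A -> B -> M),
             balanced phi -> tensor_eval phi s = tensor_eval phi t)
          (s == t %[mod tensor]).
Proof. by rewrite piE; exact: tensor_relP. Qed.

Lemma tensor_eval_repr (M : zmodType) (phi : A -> B -> M) s :
  balanced phi -> tensor_eval phi (repr (\pi_tensor s)) = tensor_eval phi s.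
Proof. by move=> b; apply: (tensor_eqP _ _ _) b; rewrite reprK. Qed.

Definition seq_opp (s : seq (A * B)) : seq (A * B) :=
  [seq (- z.1, z.2) | z <- s].

Definition seq_mul (s t : seq (A * B)) : seq (A * B) :=
  [seq (z.1 * w.1, z.2 * w.2) | z <- s, w <- t].

Definition tensor_zero : tensor := \pi_tensor [::].
Definition tensor_one : tensor := \pi_tensor [:: (1, 1)].
Definition tensor_opp (s : tensor) : tensor := \pi_tensor (seq_opp (repr s)).
Definition tensor_add (s t : tensor) : tensor := \pi_tensor (repr s ++ repr t).
Definition tensor_mul (s t : tensor) : tensor := \pi_tensor (seq_mul (repr s) (repr t)).

Lemma balanced0 (M : zmodType) (phi : A -> B -> M) y : balanced phi -> phi 0 y = 0.
Proof. by case=> D _ _; apply: (addrI (phi 0 y)); rewrite -D !addr0. Qed.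

Lemma balancedN (M : zmodType) (phi : A -> B -> M) x y :
  balanced phi -> phi (- x) y = - phi x y.
Proof.
move=> b; have [D _ _] := b; apply: (addrI (phi x y)).
by rewrite -D !subrr balanced0.
Qed.

Lemma balanced_mul (M : zmodType) (phi : A -> B -> M) u v :
  balanced phi -> balanced (fun x y => phi (x * u) (y * v)).
Proof.
case=> D E F; split=> *; first by rewrite mulrDl D.
  by rewrite mulrDl E.
by rewrite -!mulrA F.
Qed.

Lemma tensor_eval_cat (M : zmodType) (phi : A -> B -> M) s t :
  tensor_eval phi (s ++ t) = tensor_eval phi s + tensor_eval phi t.
Proof. exact: big_cat. Qed.

Lemma tensor_eval_opp (M : zmodType) (phi : A -> B -> M) s :
  balanced phi -> tensor_eval phi (seq_opp s) = - tensor_eval phi s.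
Proof.
move=> b; rewrite /tensor_eval big_map -sumrN.
by apply: eq_bigr => z _; rewrite /= balancedN.
Qed.

Lemma tensor_eval_mul (M : zmodType) (phi : A -> B -> M) s t :
  tensor_eval phi (seq_mul s t) =
  \sum_(w <- t) tensor_eval (fun x y => phi (x * w.1) (y * w.2)) s.
Proof. by rewrite /tensor_eval big_allpairs_dep /= exchange_big. Qed.

Lemma seq_mulC s t (M : zmodType) (phi : A -> B -> M) :
  tensor_eval phi (seq_mul s t) = tensor_eval phi (seq_mul t s).
Proof.
rewrite /tensor_eval !big_allpairs_dep /= exchange_big /=.
by apply: eq_bigr => w _; apply: eq_bigr => z _; rewrite mulrC [z.2 * _]mulrC.
Qed.

Lemma tensor_piD s t : \pi_tensor (s ++ t) = tensor_add (\pi s) (\pi t).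
Proof.
by apply/eqP/tensor_eqP => M phi b; rewrite !tensor_eval_cat !tensor_eval_repr.
Qed.

Lemma tensor_piN s : \pi_tensor (seq_opp s) = tensor_opp (\pi s).
Proof.
by apply/eqP/tensor_eqP => M phi b; rewrite !tensor_eval_opp ?tensor_eval_repr.
Qed.

Lemma tensor_piM s t : \pi_tensor (seq_mul s t) = tensor_mul (\pi s) (\pi t).
Proof.
have H u v (M : zmodType) (phi : A -> B -> M) : balanced phi ->
    tensor_eval phi (seq_mul (repr (\pi_tensor u)) v) = tensor_eval phi (seq_mul u v).
  move=> b; rewrite !tensor_eval_mul; apply: eq_bigr => w _.
  by rewrite tensor_eval_repr //; exact: balanced_mul.
apply/eqP/tensor_eqP => M phi b.
by rewrite H // [RHS]seq_mulC H // seq_mulC.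
Qed.

Lemma tensor_addA : associative tensor_add.
Proof.
by move=> x y z; rewrite -[x]reprK -[y]reprK -[z]reprK -!tensor_piD catA.
Qed.

Lemma tensor_addC : commutative tensor_add.
Proof.
move=> x y; rewrite -[x]reprK -[y]reprK -!tensor_piD.
by apply/eqP/tensor_eqP => M phi b; rewrite !tensor_eval_cat addrC.
Qed.

Lemma tensor_add0 : left_id tensor_zero tensor_add.
Proof. by move=> x; rewrite -[x]reprK -tensor_piD. Qed.

Lemma tensor_addN : left_inverse tensor_zero tensor_opp tensor_add.
Proof.
move=> x; rewrite -[x]reprK -tensor_piN -tensor_piD.
apply/eqP/tensor_eqP => M phi b.
by rewrite tensor_eval_cat tensor_eval_opp // addNr /tensor_eval big_nil.
Qed.

HB.instance Definition _ :=
  GRing.isZmodule.Build tensor tensor_addA tensor_addC tensor_add0 tensor_addN.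

Lemma tensor_mulC : commutative tensor_mul.
Proof.
move=> x y; rewrite -[x]reprK -[y]reprK -!tensor_piM.
by apply/eqP/tensor_eqP => M phi b; rewrite seq_mulC.
Qed.

Lemma tensor_mulA : associative tensor_mul.
Proof.
move=> x y z; rewrite -[x]reprK -[y]reprK -[z]reprK -!tensor_piM.
apply/eqP/tensor_eqP => M phi b; rewrite /tensor_eval !big_allpairs_dep /=.
apply: eq_bigr => u _; rewrite big_allpairs_dep.
by apply: eq_bigr => v _; apply: eq_bigr => w _; rewrite /= !mulrA.
Qed.

Lemma tensor_mul1 : left_id tensor_one tensor_mul.
Proof.
move=> x; rewrite -[x]reprK -tensor_piM /seq_mul /= cats0; congr \pi.
by rewrite -[RHS]map_id; apply: eq_map => -[u v]; rewrite !mul1r.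
Qed.

Lemma tensor_mulD : left_distributive tensor_mul +%R.
Proof.
move=> x y z; rewrite -[x]reprK -[y]reprK -[z]reprK.
rewrite -[_ + _]tensor_piD -!tensor_piM -[RHS]tensor_piD.
by rewrite /seq_mul allpairs_cat.
Qed.

HB.instance Definition _ :=
  GRing.Zmodule_isComPzRing.Build tensor
    tensor_mulA tensor_mulC tensor_mul1 tensor_mulD.

Definition tensor_pure (x : A) (y : B) : tensor := \pi_tensor [:: (x, y)].

Lemma tensor_balanced : balanced tensor_pure.
Proof.
split=> [x x' y|x y y'|r x y]; rewrite -?[RHS]tensor_piD;
  apply/eqP/tensor_eqP=> M phi b; have [D E F] := b.
- by rewrite /tensor_eval !big_cons !big_nil /= !addr0 D.
- by rewrite /tensor_eval !big_cons !big_nil /= !addr0 E.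
- by rewrite /tensor_eval !big_cons !big_nil /= F.
Qed.

Lemma tensor_span (t : tensor) : t = \sum_(z <- repr t) tensor_pure z.1 z.2.
Proof.
rewrite -[LHS]reprK; elim: (repr t) => [|[x y] s IH]; first by rewrite big_nil.
by rewrite big_cons -IH -[RHS]tensor_piD.
Qed.

Lemma tensor_lift (M : zmodType) (phi : A -> B -> M) : balanced phi ->
  exists F : {additive tensor -> M}, forall x y, F (tensor_pure x y) = phi x y.
Proof.
move=> b; pose F (t : tensor) := tensor_eval phi (repr t).
have FB : zmod_morphism F.
  move=> s t; rewrite -[s]reprK -[t]reprK -[- _]tensor_piN -[_ + _]tensor_piD /F.
  by rewrite !tensor_eval_repr // tensor_eval_cat tensor_eval_opp.
pose Fm := GRing.isZmodMorphism.Build _ _ F FB.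
pose Fa : {additive tensor -> M} := HB.pack F Fm.
exists Fa => x y; rewrite /Fa /=.
by rewrite /F tensor_eval_repr // /tensor_eval big_seq1.
Qed.

Lemma tensor_pureM x y x' y' :
  tensor_pure x y * tensor_pure x' y' = tensor_pure (x * x') (y * y').
Proof. by rewrite -[LHS]tensor_piM. Qed.

Definition tensor_inr (y : B) : tensor := tensor_pure 1 y.

(* g (x) id_B, meaningful when g is R-linear: see tensor_mapl_pure. *)
Definition tensor_mapl (g : A -> A) (t : tensor) : tensor :=
  \sum_(z <- repr t) tensor_pure (g z.1) z.2.

Lemma tensor_mapl_pure (g : A -> A) :
    {morph g : x x' / x + x'} -> (forall r x, g (alpha r * x) = alpha r * g x) ->
  forall x y, tensor_mapl g (tensor_pure x y) = tensor_pure (g x) y.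
Proof.
move=> gD gZ x y; pose phi u v := tensor_pure (g u) v.
have b : balanced phi.
  have [D E F] := tensor_balanced.
  by split=> *; rewrite /phi ?gD ?D ?E ?gZ ?F.
by rewrite -[LHS](tensor_eval_repr _ b) reprK [LHS](tensor_eval_repr _ b)
  /tensor_eval big_seq1.
Qed.

End Tensor.

Arguments tensor_inr {R A B} alpha beta y.
Arguments tensor_mapl {R A B} alpha beta g t.

Definition Zrho (p : nat) : comNzRingType :=
  {poly %/ (\sum_(i < p) 'X^i : {poly int})}.
Definition rho (p : nat) : Zrho p := 'qX.

(* The rings R and T, over a base ring A with elements r and xi; they are used
   for A = Z[rho] and r = rho. *)
Section Generic.
Variables (A : comNzRingType) (p : nat) (r : A).

Definition eta : A := r - 1.

(* R = A[u][1/(1 + u eta^p)] is the quotient of A[u][w] by the ideal generated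
   by (1 + u eta^p) w - 1. *)
Definition den : {poly A} := 1 + eta ^+ p *: 'X.

Definition loc_ideal (q : {poly {poly A}}) : bool :=
  `[< exists t, q = t * (den *: 'X - 1) >].

Lemma loc_ideal_closed : idealr_closed loc_ideal.
Proof.
split=> [||a x y /asboolP[t ->] /asboolP[v ->]].
- by apply/asboolP; exists 0; rewrite mul0r.
- apply/negP => /asboolP[t /(congr1 (fun q : {poly {poly A}} => q.[1].[0]))].
  rewrite !hornerM; have -> : (den *: 'X - 1 : {poly {poly A}}).[1] = eta ^+ p *: 'X.
    by rewrite hornerD hornerN hornerZ hornerX hornerC mulr1 /den addrC addKr.
  rewrite hornerZ hornerX !mulr0 !hornerC.
  by apply/eqP; exact: oner_neq0.
- by apply/asboolP; exists (a * t + v); rewrite mulrDl mulrA.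
Qed.

HB.instance Definition _ :=
  isIdealr.Build {poly {poly A}} loc_ideal loc_ideal_closed.

Definition Rgen : comNzRingType :=
  {ideal_quot (loc_ideal : idealr {poly {poly A}})}.
Definition Rgen_pi : {rmorphism {poly {poly A}} -> Rgen} :=
  \pi_({ideal_quot (loc_ideal : idealr {poly {poly A}})}).
Definition to_Rgen : {rmorphism A -> Rgen} := Rgen_pi \o polyC \o polyC.
Definition Rgen_u : Rgen := Rgen_pi 'X%:P.

Variable xi : A.

Definition g : {poly A} :=
  xi *: \sum_(1 <= i < p) (('C(p, i) %/ p)%N%:R * eta ^+ i.-1) *: 'X^i.

Definition Tpoly : {poly Rgen} := 'X^p + map_poly to_Rgen g - Rgen_u%:P.

Definition Tgen : comNzRingType := {poly %/ Tpoly}.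
Definition to_Tgen : {rmorphism Rgen -> Tgen} := qpolyC Tpoly.
Definition theta : Tgen := 'qX.

(* The R-algebra map with sigma(theta) = r theta + 1: an element of T is
   represented by a polynomial in Z, which is evaluated at r theta + 1. *)
Definition Tsigma (t : {poly %/ Tpoly}) : Tgen :=
  (map_poly to_Tgen t).[to_Tgen (to_Rgen r) * theta + 1].

Lemma size_Tpoly_low : (0 < p)%N ->
  (size (map_poly to_Rgen g - Rgen_u%:P)%R <= p)%N.
Proof.
move=> p_gt0; rewrite (leq_trans (size_polyD _ _)) // size_polyN geq_max.
rewrite (leq_trans (size_polyC_leq1 _)) // andbT.
rewrite (leq_trans (size_poly _ _)) // (leq_trans (size_scale_leq _ _)) //.
apply: (leq_trans (size_sum _ _ _)); apply/bigmax_leqP_seq => i.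
rewrite mem_index_iota => /andP[_ ip] _.
by rewrite (leq_trans (size_scale_leq _ _)) // size_polyXn.
Qed.

Lemma size_Tpoly : (0 < p)%N -> size Tpoly = p.+1.
Proof.
move=> p_gt0; rewrite /Tpoly -addrA size_polyDl size_polyXn //.
by rewrite ltnS size_Tpoly_low.
Qed.

Lemma Tpoly_monic : (0 < p)%N -> Tpoly \is monic.
Proof.
move=> p_gt0; rewrite monicE /Tpoly -addrA lead_coefDl ?lead_coefXn //.
by rewrite size_polyXn ltnS size_Tpoly_low.
Qed.

Lemma mk_monic_Tpoly : (0 < p)%N -> mk_monic Tpoly = Tpoly.
Proof. by move=> p0; rewrite /mk_monic Tpoly_monic // size_Tpoly // ltnS p0. Qed.

Lemma TsigmaD : {morph Tsigma : t t' / t + t'}.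
Proof. by move=> t t'; rewrite /Tsigma rmorphD hornerD. Qed.

Lemma TsigmaZ c t : Tsigma (to_Tgen c * t) = to_Tgen c * Tsigma t.
Proof.
rewrite /Tsigma; have -> : (to_Tgen c * t : {poly %/ Tpoly}) = c *: t :> {poly Rgen}.
  rewrite poly_of_qpolyM qpolyCE mul_polyC -poly_of_qpolyZ.
  by apply: in_qpoly_small; exact: size_mk_monic.
by rewrite map_polyZ hornerZ.
Qed.

Lemma Tsigma_theta : (1 < p)%N ->
  Tsigma theta = to_Tgen (to_Rgen r) * theta + 1.
Proof.
move=> p_gt1; rewrite /Tsigma /theta qpolyXE ?map_polyX ?hornerX //.
  by rewrite size_Tpoly // ltnW.
by rewrite Tpoly_monic // ltnW.
Qed.

End Generic.

Arguments Tsigma {A} p r xi t.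

(* Main.v *)
(* Put eta = rho - 1 and F(Z) = Z^p + g(Z), so that (1 + eta Z)^p =
   1 + eta^p F(Z) and F(rho Z + 1) = F(Z).  As S' has an element of trace 1,
   the 1-cocycle condition for sigma(theta) = rho theta + 1 is solvable in S',
   and F(theta) is fixed by sigma, say F(theta) = u in R'.  Every solution
   arises from theta by adding some x with sigma(x) = rho x.  At a maximal ideal
   m of R' there is y with sigma(y) = rho y and y^p not in m (the Lagrange
   resolvents generate the unit ideal of S'), and a Chinese remainder argument
   on the finitely many m lets one choose theta with 1 + u eta^p =
   (1 + eta theta)^p outside all of them.  Then 1 + u eta^p is a unit, so that
   u defines h : R -> R'.  The differences of the conjugates of theta are
   cyclotomic units times 1 + eta theta, hence their Vandermonde determinant is
   a unit and 1, theta, ..., theta^(p-1) is a basis of S' over R'. *)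
From HB Require Import structures.
Require Import Defs.
From mathcomp Require Import all_boot all_order all_algebra.
From mathcomp Require Import boolp classical_sets.
From mathcomp Require Import ring.

Set Implicit Arguments.
Unset Strict Implicit.
Unset Printing Implicit Defensive.

Import GRing.Theory.
Local Open Scope ring_scope.
Local Open Scope quotient_scope.

(** * Maximal ideals *)

Section Ideals.
Variable A : comPzRingType.
Implicit Types I J : A -> Prop.

Lemma proper_ideal_sub_maximal I : is_ideal I -> ~ I 1 ->
  exists J, maximal_ideal J /\ forall x, I x -> J x.
Proof.
move=> [I0 ID IM] I1.
(* Zorn's lemma is applied to sets [X] whose union with [I] is a proper ideal, so that the empty
   chain, with its empty union, needs no separate treatment. *)
pose P (X : set A) := is_ideal (I `|` X)%classic /\ ~ (I `|` X)%classic 1.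
have [F FP Ftot|X [[idX X1] maxX]] := @Zorn_bigcup A P.
  split; last by case=> // -[X FX X1]; case: (FP X FX) => _; apply; right.
  split=> [|x y|a x]; first by left.
    case=> [Ix|[X FX Xx]] [Iy|[Y FY Yy]].
    - by left; exact: ID.
    - have [[_ D _] _] := FP Y FY.
      by case: (D x y (or_introl Ix) (or_intror Yy)) => ?; [left|right; exists Y].
    - have [[_ D _] _] := FP X FX.
      by case: (D x y (or_intror Xx) (or_introl Iy)) => ?; [left|right; exists X].
    have [XY|YX] := Ftot X Y FX FY.
      have [[_ D _] _] := FP Y FY.
      by case: (D x y (or_intror (XY _ Xx)) (or_intror Yy)) => ?;
        [left|right; exists Y].
    have [[_ D _] _] := FP X FX.
    by case: (D x y (or_intror Xx) (or_intror (YX _ Yy))) => ?;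
      [left|right; exists X].
  case=> [Ix|[X FX Xx]]; first by left; exact: IM.
  have [[_ _ M] _] := FP X FX.
  by case: (M a x (or_intror Xx)) => ?; [left|right; exists X].
exists (I `|` X)%classic; split; last by left.
split=> // J idJ J1 XJ x Jx; apply: contrapT => nXx.
have IJ : (I `|` J)%classic = J.
  by apply/seteqP; split=> [z [/or_introl/XJ|]|z] //; right.
apply: (maxX J); last by rewrite /P IJ.
by split=> [z Xz|JX]; [apply: XJ; right|apply: nXx; right; exact: JX].
Qed.

(** Otherwise the ideal [I + a A] would be proper, hence equal to [I] by maximality, and it contains
    [a]. *)
Lemma maximal_ideal_inv I a : maximal_ideal I -> ~ I a ->
  exists c, I (1 - a * c).
Proof.
move=> [[I0 ID IM] I1 maxI] nIa; apply: contrapT => nc.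
pose J x := exists c, I (x - a * c).
apply: (nIa); apply: (maxI J); last by exists 1; rewrite mulr1 subrr.
- split=> [|x y [c Ic] [d Id]|b x [c Ic]].
  + by exists 0; rewrite mulr0 subrr.
  + exists (c + d); have -> : x + y - a * (c + d) = (x - a * c) + (y - a * d) by ring.
    exact: ID.
  + exists (b * c); have -> : b * x - a * (b * c) = b * (x - a * c) by ring.
    exact: IM.
- by case=> c Ic; apply: nc; exists c.
- by move=> x Ix; exists 0; rewrite mulr0 subr0.
Qed.

Lemma maximal_ideal_prime I a b : maximal_ideal I -> I (a * b) -> I a \/ I b.
Proof.
move=> maxI Iab; have [[I0 ID IM] _ _] := maxI.
have [|/(maximal_ideal_inv maxI)[c Ic]] := pselect (I a); first by left.
right; have -> : b = b * (1 - a * c) + c * (a * b) by ring.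
by apply: ID; exact: IM.
Qed.

Lemma maximal_ideal_prime_exp I a n : maximal_ideal I -> I (a ^+ n) -> I a.
Proof.
move=> maxI; have [_ I1 _] := maxI.
elim: n => [/I1//|n IH]; rewrite exprS => /(maximal_ideal_prime maxI)[] //.
Qed.

(** A non-unit generates a proper ideal, which lies in a maximal one. *)
Lemma unit_of_maximal a :
  (forall I, maximal_ideal I -> ~ I a) -> exists b, a * b = 1.
Proof.
move=> aP; apply: contrapT => na.
have [|[b ab]|J [maxJ Ja]] := @proper_ideal_sub_maximal (fun x => exists b, x = a * b).
- split=> [|x y [b ->] [c ->]|b x [c ->]].
  + by exists 0; rewrite mulr0.
  + by exists (b + c); rewrite mulrDr.
  + by exists (b * c); rewrite mulrCA.
- by apply: na; exists b.
- by apply: (aP J maxJ); apply: Ja; exists 1; rewrite mulr1.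
Qed.

Section Congruence.
Variable I : A -> Prop.
Hypothesis idI : is_ideal I.

Lemma is_idealN x : I x -> I (- x).
Proof. by case: idI => _ _ IM Ix; rewrite -mulN1r; exact: IM. Qed.

Lemma is_idealB x y : I x -> I y -> I (x - y).
Proof. by case: idI => _ ID _ Ix Iy; apply: ID => //; exact: is_idealN. Qed.

Lemma is_ideal_sum (K : Type) (r : seq K) (P : pred K) (F : K -> A) :
  (forall k, P k -> I (F k)) -> I (\sum_(k <- r | P k) F k).
Proof. by case: idI => I0 ID _ IF; apply: big_ind. Qed.

Lemma is_ideal_congM x x' y y' : I (x - x') -> I (y - y') -> I (x * y - x' * y').
Proof.
case: idI => _ ID IM Ix Iy.
have -> : x * y - x' * y' = y * (x - x') + x' * (y - y') by ring.
by apply: ID; exact: IM.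
Qed.

Lemma is_ideal_congX x y n : I (x - y) -> I (x ^+ n - y ^+ n).
Proof.
move=> Ixy; elim: n => [|n IH]; first by case: idI => I0 _ _; rewrite !expr0 subrr.
by rewrite !exprS; exact: is_ideal_congM.
Qed.

Lemma is_ideal_cong_det n (M N : 'M[A]_n) :
  (forall i j, I (M i j - N i j)) -> I (\det M - \det N).
Proof.
have [I0 ID IM] := idI => MN; rewrite -sumrB; apply: is_ideal_sum => s _.
rewrite -mulrBr; apply: IM.
apply: (big_ind2 (fun x y => I (x - y))) => [|x x' y y'|i _] //.
  by rewrite subrr.
exact: is_ideal_congM.
Qed.

End Congruence.

(** A piece of the Chinese remainder theorem: distinct maximal ideals are incomparable, and a
    product of elements outside the prime ideal [I] stays outside it. Entries of [m] that are not
    maximal are skipped, because [semilocal] only asks that the list contain every maximal ideal. *)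
Lemma maximal_ideal_avoid n (m : 'I_n -> A -> Prop) I k : maximal_ideal I ->
  (forall i : 'I_n, (i < k)%N -> maximal_ideal (m i) -> ~ (forall x, I x <-> m i x)) ->
  exists e, ~ I e /\ forall i : 'I_n, (i < k)%N -> maximal_ideal (m i) -> m i e.
Proof.
move=> maxI; have [idI I1 _] := maxI; elim: k => [|k IH] mI.
  by exists 1; split.
have [|e [Ie me]] := IH; first by move=> i ik; apply: mI; exact: ltnW.
have [kn|nk] := ltnP k n; last first.
  exists e; split=> // i _; apply: me.
  exact: leq_trans (ltn_ord i) nk.
pose j := Ordinal kn.
have [maxj|nmaxj] := pselect (maximal_ideal (m j)); last first.
  exists e; split=> // i; rewrite ltnS leq_eqVlt => /orP[/eqP ik|]; last exact: me.
  by have -> : i = j by exact: val_inj.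
have [[_ _ jM] j1 jmax] := maxj.
have [d [md Id]] : exists d, m j d /\ ~ I d.
  apply: contrapT => nd; have jI x : m j x -> I x.
    by move=> mx; apply: contrapT => Ix; apply: nd; exists x.
  apply: (mI j) => // x; split; last exact: jI.
  by move: x; apply: jmax.
exists (d * e); split=> [/(maximal_ideal_prime maxI)[]//|i].
rewrite ltnS leq_eqVlt => /orP[/eqP ik _|ik maxi].
  have -> : i = j by exact: val_inj.
  by rewrite mulrC; exact: jM.
by have [[_ _ iM] _ _] := maxi; apply: iM; exact: me.
Qed.

End Ideals.

(** * Trace and eigenvectors in a cyclic Galois extension *)

Section IterMorphism.
Variables (S : pzRingType) (sigma : {rmorphism S -> S}) (k : nat).

Lemma iter_is_zmod_morphism : zmod_morphism (iter k sigma).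
Proof. by elim: k => [|n IH] x y //; rewrite !iterS IH rmorphB. Qed.

Lemma iter_is_monoid_morphism : monoid_morphism (iter k sigma).
Proof.
elim: k => [|n [IH1 IHM]]; first by split.
by split=> [|x y]; rewrite !iterS ?IH1 ?rmorph1 // IHM rmorphM.
Qed.

HB.instance Definition _ :=
  GRing.isZmodMorphism.Build S S (iter k sigma) iter_is_zmod_morphism.
HB.instance Definition _ :=
  GRing.isMonoidMorphism.Build S S (iter k sigma) iter_is_monoid_morphism.

End IterMorphism.

Section Galois.
Variables (p : nat) (R S : comPzRingType).
Variables (iota : {rmorphism R -> S}) (sigma : {rmorphism S -> S}).
Hypothesis p_gt0 : (0 < p)%N.
Hypothesis galS : Cp_galois p iota sigma.

Lemma iter_linear k r : iter k sigma (iota r) = iota r.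
Proof. by elim: k => //= k ->; exact: Cp_linear galS _. Qed.

(** Cyclic shift of the index: the terms at [0] and [p] agree because [sigma] has order dividing
    [p]. This makes traces invariant and resolvents eigenvectors. *)
Lemma sum_iterS (a : nat -> S) z : a p = a 0%N ->
  \sum_(k < p) a k.+1 * iter k.+1 sigma z = \sum_(k < p) a k * iter k sigma z.
Proof.
move=> ap; pose F k := a k * iter k sigma z.
apply: (addrI (F 0%N)); rewrite -(big_ord_recl p F) big_ord_recr /= addrC.
by rewrite /F ap (Cp_action galS).
Qed.

Definition trace x := \sum_(k < p) iter k sigma x.

Lemma traceD x y : trace (x + y) = trace x + trace y.
Proof. by rewrite -big_split; apply: eq_bigr => k _; rewrite rmorphD. Qed.

Lemma trace0 : trace 0 = 0.
Proof. by apply: big1 => k _; rewrite rmorph0. Qed.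

Lemma traceZ r x : trace (iota r * x) = iota r * trace x.
Proof. by rewrite mulr_sumr; apply: eq_bigr => k _; rewrite rmorphM /= iter_linear. Qed.

Lemma trace_fixed x : exists r, trace x = iota r.
Proof.
apply: (Cp_fixed galS); rewrite rmorph_sum.
have := @sum_iterS (fun=> 1) x erefl.
by under eq_bigr do rewrite mul1r; under [in RHS]eq_bigr do rewrite mul1r.
Qed.

(* Determinant trick: the trace ideal I satisfies S = I S, and the matrix
   (tr (y_j x_i)) in I gives an element of 1 + I annihilating S. *)
Lemma trace1 : exists t, trace t = 1.
Proof.
have [xy xyP] := Cp_separable galS.
(* Separability yields dual bases: the [x_j] generate [S] over [R], with coordinates
   [tr (y_j s)]. *)
have dual s : \sum_(z <- xy) z.1 * trace (z.2 * s) = s.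
  transitivity (\sum_(k < p) \sum_(z <- xy) z.1 * iter k sigma z.2 * iter k sigma s).
    rewrite exchange_big; apply: eq_bigr => z _; rewrite mulr_sumr.
    by apply: eq_bigr => k _; rewrite rmorphM mulrA.
  under eq_bigr do rewrite -mulr_suml xyP //.
  rewrite (bigD1 (Ordinal p_gt0)) //= mul1r big1 ?addr0 // => k.
  by rewrite -val_eqE /= => /negPf->; rewrite mul0r.
pose I r := exists x, iota r = trace x.
have idI : is_ideal I.
  split=> [|r q [x rx] [y qy]|a r [x rx]].
  - by exists 0; rewrite rmorph0 trace0.
  - by exists (x + y); rewrite rmorphD traceD rx qy.
  - by exists (iota a * x); rewrite traceZ rmorphM rx.
pose n := size xy; pose e (i : 'I_n) := nth (0, 0) xy i.
have /choice[a aP] : forall ij : 'I_n * 'I_n, exists r,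
    iota r = trace ((e ij.2).2 * (e ij.1).1).
  by move=> ij; have [r ->] := trace_fixed ((e ij.2).2 * (e ij.1).1); exists r.
pose M := \matrix_(i, j) ((i == j)%:R - a (i, j)).
have ker : map_mx iota M *m (\col_i (e i).1) = 0.
  apply/matrixP => i j; rewrite !mxE.
  under eq_bigr do rewrite !mxE rmorphB mulrBl rmorph_nat aP /=.
  rewrite sumrB (bigD1 i) //= eqxx mul1r big1 ?addr0 => [|k /negPf ki]; last first.
    by rewrite eq_sym ki mul0r.
  apply/eqP; rewrite subr_eq0; apply/eqP.
  rewrite -[LHS]dual (big_nth (0, 0)) big_mkord.
  by apply: eq_bigr => k _; rewrite mulrC.
have ker2 i : iota (\det M) * (e i).1 = 0.
  have := congr1 (mulmx (\adj (map_mx iota M))) ker.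
  rewrite mulmxA mul_adj_mx mulmx0 det_map_mx mul_scalar_mx.
  by move/matrixP/(_ i 0); rewrite !mxE.
(* [\det M] kills every [x_i], hence also [\sum_i x_i y_i = 1]. *)
have det0 : \det M = 0.
  apply: (Cp_injective galS); rewrite rmorph0 -[LHS]mulr1.
  rewrite -[1](xyP 0%N p_gt0) mulr_sumr (big_nth (0, 0)) big_mkord.
  by apply: big1 => i _; rewrite mulrA ker2 mul0r.
have [x] : I (\det (1%:M : 'M[R]_n) - \det M).
  apply: is_ideal_cong_det => // i j; rewrite !mxE opprB addrC subrK.
  by exists ((e j).2 * (e i).1); rewrite aP.
by rewrite det1 det0 subr0 rmorph1 => x1; exists x.
Qed.

Section ExtendedIdeal.
Variable m : R -> Prop.
Hypothesis idm : is_ideal m.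

(* This is the ideal m S, described through traces so that its contraction to R
   is visibly m. *)
Definition extended s := forall z, exists2 a, m a & trace (z * s) = iota a.

Lemma extended_ideal : is_ideal extended.
Proof.
have [m0 mD mM] := idm.
split=> [z|x y Jx Jy z|a x Jx z].
- by exists 0; rewrite ?mulr0 ?rmorph0 ?trace0.
- have [a ma az] := Jx z; have [b mb bz] := Jy z.
  by exists (a + b); rewrite ?rmorphD ?mulrDr ?traceD ?az ?bz //; exact: mD.
- by have [b mb bz] := Jx (z * a); exists b; rewrite ?mulrA.
Qed.

(** Testing [iota r] against an element of trace 1 gives back [iota r] itself. *)
Lemma extendedE r : extended (iota r) <-> m r.
Proof.
have [m0 mD mM] := idm; split=> [/(_ _)|mr z]; last first.
  have [a az] := trace_fixed z; exists (a * r); first exact: mM.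
  by rewrite mulrC traceZ az rmorphM mulrC.
have [t t1] := trace1; move=> /(_ t)[a ma].
by rewrite mulrC traceZ t1 mulr1 => /(Cp_injective galS) ->.
Qed.

End ExtendedIdeal.

Section Eigen.
Variable r : S.
Hypothesis r_fix : sigma r = r.
Hypothesis rp : \sum_(i < p) r ^+ i = 0.

Lemma root_exp1 : r ^+ p = 1.
Proof. by apply/eqP; rewrite -subr_eq0 subrX1 rp mulr0. Qed.

(** The Lagrange resolvent; the exponent [p - k] stands for [-k], as [r ^+ p = 1]. *)
Definition resolvent z := \sum_(k < p) r ^+ (p - k) * iter k sigma z.

Lemma resolvent_eigen z : sigma (resolvent z) = r * resolvent z.
Proof.
rewrite {2}/resolvent -(sum_iterS (a := fun k => r ^+ (p - k))).
  rewrite rmorph_sum mulr_sumr; apply: eq_bigr => k _.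
  by rewrite rmorphM rmorphXn /= r_fix mulrA -exprS subnSK.
by rewrite subnn subn0 root_exp1.
Qed.

Lemma eigen_fixed y : sigma y = r * y -> exists c, y ^+ p = iota c.
Proof.
move=> ys; apply: (Cp_fixed galS).
by rewrite rmorphXn /= ys exprMn root_exp1 mul1r.
Qed.

(** If every eigenvector had its [p]-th power in [m], all resolvents would lie in a maximal, hence
    prime, ideal [J] above [m S]. But the Galois condition gives
    [\sum_j x_j * resolvent y_j = r ^+ p = 1]. *)
Lemma eigen_avoid m : maximal_ideal m ->
  exists y c, [/\ sigma y = r * y, y ^+ p = iota c & ~ m c].
Proof.
move=> maxm; have [idm m1 _] := maxm.
have nm1 : ~ extended m 1 by rewrite -(rmorph1 iota) => /(extendedE idm _).
have [J [maxJ mJ]] := proper_ideal_sub_maximal (extended_ideal idm) nm1.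
have [idJ J1 _] := maxJ; have [_ _ JM] := idJ.
apply: contrapT => ny; apply: J1.
have JL z : J (resolvent z).
  apply: (maximal_ideal_prime_exp (n := p) maxJ).
  have [c cE] := eigen_fixed (resolvent_eigen z); rewrite cE.
  apply: mJ; apply/extendedE => //; apply: contrapT => nc; apply: ny.
  by exists (resolvent z), c; split=> //; exact: resolvent_eigen.
have [xy xyP] := Cp_separable galS.
have <- : \sum_(z <- xy) z.1 * resolvent z.2 = 1.
  transitivity (\sum_(k < p) r ^+ (p - k) * \sum_(z <- xy) z.1 * iter k sigma z.2).
    rewrite (eq_bigr (fun z => \sum_(k < p) r ^+ (p - k) * (z.1 * iter k sigma z.2))).
      by rewrite exchange_big; apply: eq_bigr => k _; rewrite mulr_sumr.
    by move=> z _; rewrite mulr_sumr; apply: eq_bigr => k _; rewrite mulrCA.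
  under eq_bigr do rewrite xyP //.
  rewrite (bigD1 (Ordinal p_gt0)) //= subn0 root_exp1 mulr1 big1 ?addr0 // => k.
  by rewrite -val_eqE /= => /negPf->; rewrite mulr0.
by apply: is_ideal_sum => // z _; exact: JM.
Qed.

(* With tr t = 1, theta = \sum_k [p-1-k]_r sigma^k(t) where [n]_r is the
   r-integer: [n+1]_r = 1 + r [n]_r and [p]_r = 0. *)
Lemma affine_eigen : exists th, sigma th = r * th + 1.
Proof.
have [t t1] := trace1.
pose q n := \sum_(i < n) r ^+ i.
have qS n : q n.+1 = 1 + r * q n.
  rewrite /q big_ord_recl expr0 mulr_sumr; congr (_ + _).
  by apply: eq_bigr => i _; rewrite -exprS.
exists (\sum_(k < p) q (p.-1 - k)%N * iter k sigma t).
have q_fix n : sigma (q n) = q n.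
  by rewrite rmorph_sum; apply: eq_bigr => i _; rewrite rmorphXn /= r_fix.
(* [b k] is [q (p - k)], written so that [b k.+1] is literally the coefficient in the sum; it closes
   up cyclically because [q 0] and [q p] both vanish. *)
pose b k := if k is k'.+1 then q (p.-1 - k')%N else q p.
have bp : b p = b 0%N.
  rewrite /b -(prednK p_gt0) /= subnn {1}/q big_ord0 prednK //.
rewrite rmorph_sum (eq_bigr (fun k : 'I_p => b k.+1 * iter k.+1 sigma t)); last first.
  by move=> k _; rewrite rmorphM /= q_fix.
rewrite sum_iterS // -t1 mulr_sumr -big_split; apply: eq_bigr => k _ /=.
rewrite mulrA -[X in _ + X]mul1r -mulrDl; congr (_ * _).
case: k => -[|k] kp /=; first by rewrite subn0 addrC -qS prednK.
by rewrite addrC -qS subnS prednK // subn_gt0 -ltnS prednK.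
Qed.

End Eigen.
End Galois.

(** * The Kummer polynomial *)

Section CyclotomicUnits.
Variables (A : comPzRingType) (p : nat) (r : A).
Hypothesis rp : \sum_(i < p) r ^+ i = 0.

Lemma geometric_sumD m n :
  \sum_(i < m + n) r ^+ i = \sum_(i < m) r ^+ i + r ^+ m * \sum_(i < n) r ^+ i.
Proof.
rewrite big_split_ord; congr (_ + _); rewrite mulr_sumr.
by apply: eq_bigr => i _; rewrite /= exprD.
Qed.

Lemma geometric_sumM m n :
  \sum_(i < m * n) r ^+ i = (\sum_(i < n) r ^+ i) * \sum_(j < m) r ^+ (n * j).
Proof.
elim: m => [|m IH]; first by rewrite mul0n !big_ord0 mulr0.
rewrite mulSn addnC geometric_sumD IH big_ord_recr /= mulrDr mulnC.
by rewrite [r ^+ _ * _]mulrC.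
Qed.

(** Write [[n]] for the sum of the [r ^+ i] with [i < n], and take [a k = 1 + b p]. Then [[k]]
    divides [[a k] = 1 + r [b p]], which is 1 since [[p] = 0] divides [[b p]]. *)
Lemma cyclotomic_unit k : coprime k p -> (0 < k)%N ->
  exists v, (\sum_(i < k) r ^+ i) * v = 1.
Proof.
move=> kp k0; have /(coprimeP _ k0)[[a b] /= ab] := kp.
have {}ab : (a * k = 1 + b * p)%N.
  by rewrite -ab subnK // ltnW // -subn_gt0 ab.
exists (\sum_(j < a) r ^+ (k * j)); rewrite -geometric_sumM ab.
by rewrite geometric_sumD geometric_sumM rp mul0r mulr0 addr0 big_ord1.
Qed.

End CyclotomicUnits.

Section KummerPolynomial.
Variables (A : comNzRingType) (p : nat) (r xi : A).
Hypothesis p_prime : prime p.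
Hypothesis rp : \sum_(i < p) r ^+ i = 0.
Hypothesis eta_reg : GRing.lreg (eta r).
Hypothesis xi_def : p%:R = xi * eta r ^+ p.-1.

Let F : {poly A} := 'X^p + g p r xi.

(** Binomial expansion: in the middle terms ['C(p, i)] is [p] times its quotient by [p], and
    [p = xi * eta ^+ p.-1] supplies the missing powers of [eta]. *)
Lemma kummer_poly : (1 + eta r *: 'X) ^+ p = 1 + eta r ^+ p *: F.
Proof.
have p_gt0 := prime_gt0 p_prime.
rewrite exprDn -(big_mkord xpredT
  (fun i => 1 ^+ (p - i) * (eta r *: 'X) ^+ i *+ 'C(p, i))).
rewrite big_ltn // big_nat_recr //= bin0 binn !expr1n !mul1r expr0 !mulr1n.
rewrite scalerDr exprZn; congr (_ + _); rewrite addrC; congr (_ + _).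
rewrite /g scalerA scaler_sumr; apply: eq_big_nat => i /andP[i0 ip].
rewrite expr1n mul1r exprZn scalerMnl [in RHS]scalerA; congr (_ *: _).
have /(congr1 (fun n => n%:R : A)) : ('C(p, i) = 'C(p, i) %/ p * p)%N.
  by rewrite divnK // prime_dvd_bin // i0.
rewrite -[eta r ^+ i *+ _]mulr_natl natrM xi_def => ->.
have -> : eta r ^+ p = eta r * eta r ^+ p.-1 by rewrite -exprS prednK.
have -> : eta r ^+ i = eta r * eta r ^+ i.-1 by rewrite -exprS prednK.
ring.
Qed.

(** As [1 + eta = r], the shift multiplies [1 + eta Z] by [r], whose [p]-th power is 1. The factor
    [eta ^+ p] is cancelled over [A], where it is regular; its image in an [A]-algebra may be a zero
    divisor. *)
Lemma kummer_poly_shift : F \Po (r *: 'X + 1) = F.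
Proof.
have rp1 : r ^+ p = 1 by apply/eqP; rewrite -subr_eq0 subrX1 rp mulr0.
have etap : GRing.lreg (eta r ^+ p) by exact: lregX.
suff : eta r ^+ p *: (F \Po (r *: 'X + 1)) = eta r ^+ p *: F.
  move/polyP => E; apply/polyP => i; apply: etap.
  by have := E i; rewrite !coefZ.
apply: (addrI 1); rewrite -kummer_poly.
have := congr1 (comp_poly (r *: 'X + 1)) kummer_poly.
rewrite rmorphXn rmorphD rmorphD rmorph1 /= !comp_polyZ comp_polyX => <-.
have -> : 1 + eta r *: (r *: 'X + 1) = r *: (1 + eta r *: 'X) :> {poly A}.
  rewrite /eta -!mul_polyC rmorphB rmorph1 /=; ring.
by rewrite exprZn rp1 scale1r.
Qed.

Variables (S : comNzRingType) (phi : {rmorphism A -> S}).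

Definition kummer_eval (th : S) := th ^+ p + (map_poly phi (g p r xi)).[th].

Lemma kummer_evalE th : kummer_eval th = (map_poly phi F).[th].
Proof. by rewrite rmorphD /= map_polyXn hornerD hornerXn. Qed.

Lemma kummer_eval_exp th :
  (1 + phi (eta r) * th) ^+ p = 1 + phi (eta r) ^+ p * kummer_eval th.
Proof.
have := kummer_poly; rewrite kummer_evalE; move: {1 2}F (eta r) => q e.
move/(congr1 (fun q => (map_poly phi q).[th])).
rewrite rmorphXn !rmorphD rmorph1 /=.
rewrite !map_polyZ map_polyX horner_exp.
by rewrite !hornerD !hornerZ hornerX hornerC rmorphXn.
Qed.

Lemma kummer_eval_shift th : kummer_eval (phi r * th + 1) = kummer_eval th.
Proof.
rewrite !kummer_evalE -[in RHS]kummer_poly_shift map_comp_poly horner_comp.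
rewrite [map_poly phi (_ *: _ + _)]rmorphD rmorph1 /= map_polyZ map_polyX.
by rewrite hornerD hornerZ hornerX hornerC.
Qed.

End KummerPolynomial.

(** * The cyclotomic ring and the regularity of [eta] *)

Section Zrho.
Variable p : nat.
Hypothesis p_prime : prime p.

Let Phi : {poly int} := \sum_(i < p) 'X^i.

(** [{poly %/ Phi}] is the quotient by [Phi] only when [Phi] is monic and nonconstant; otherwise
    [mk_monic] falls back to a default modulus. *)
Lemma geometric_poly_monic : (1 < size Phi)%N && (Phi \is monic).
Proof.
have -> : Phi = \poly_(i < p) 1.
  by rewrite poly_def; apply: eq_bigr => i _; rewrite scale1r.
case: p p_prime => [|n] // n_prime.
by rewrite monicE lead_coef_poly ?oner_neq0 // size_poly_eq ?oner_neq0 // prime_gt1 /=.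
Qed.

Lemma rho_sum : \sum_(i < p) rho p ^+ i = 0.
Proof.
rewrite /rho; transitivity (in_qpoly Phi Phi).
  by rewrite rmorph_sum; apply: eq_bigr => i _; rewrite rmorphXn.
apply: val_inj; rewrite /= /mk_monic geometric_poly_monic.
by rewrite Pdiv.RingMonic.rmodpp //; case/andP: geometric_poly_monic.
Qed.

Lemma Zrho_natr_lreg n : (0 < n)%N -> GRing.lreg (n%:R : Zrho p).
Proof.
move=> n0 x y; rewrite !mulr_natl => /(congr1 val) /polyP E.
apply/val_inj/polyP => i; have := E i.
by rewrite !raddfMn !coefMn => /(Num.Theory.pmulrnI n0).
Qed.

(** As [p.-1] is positive, [eta] divides [p], which is regular because the ring is torsion-free. *)
Lemma eta_lreg (xi : Zrho p) : p%:R = xi * eta (rho p) ^+ p.-1 ->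
  GRing.lreg (eta (rho p)).
Proof.
move=> xi_def x y exy; apply: (Zrho_natr_lreg (prime_gt0 p_prime)).
have p1 : (0 < p.-1)%N by rewrite -ltnS prednK ?prime_gt1 ?prime_gt0.
by rewrite xi_def -(prednK p1) exprSr mulrA -!(mulrA _ (eta _)) exy.
Qed.

End Zrho.

(** * A generator with unit norm *)

Section KummerGenerator.
Variables (A : comNzRingType) (p : nat) (r xi : A).
Hypothesis p_prime : prime p.
Hypothesis rp : \sum_(i < p) r ^+ i = 0.
Hypothesis eta_reg : GRing.lreg (eta r).
Hypothesis xi_def : p%:R = xi * eta r ^+ p.-1.
Variables (R S : comNzRingType) (f : {rmorphism A -> R}).
Variables (iota : {rmorphism R -> S}) (sigma : {rmorphism S -> S}).
Hypothesis galS : Cp_galois p iota sigma.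

Local Notation psi := (iota \o f).
Local Notation F := (kummer_eval p r xi psi).

Let p_gt0 : (0 < p)%N := prime_gt0 p_prime.

Lemma sigma_kummer_eval th : sigma (F th) = F (sigma th).
Proof.
rewrite /kummer_eval rmorphD rmorphXn -horner_map -map_poly_comp.
by congr (_ + _.[_]); apply: eq_map_poly => a /=; rewrite (Cp_linear galS).
Qed.

Lemma kummer_eval_fixed th : sigma th = psi r * th + 1 -> exists u, F th = iota u.
Proof.
move=> thE; apply: (Cp_fixed galS).
by rewrite sigma_kummer_eval thE (kummer_eval_shift p_prime rp eta_reg xi_def).
Qed.

Lemma kummer_eigen th : sigma th = psi r * th + 1 ->
  sigma (1 + psi (eta r) * th) = psi r * (1 + psi (eta r) * th).
Proof.
move=> thE; rewrite rmorphD rmorph1 rmorphM thE /= (Cp_linear galS) /eta.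
rewrite !rmorphB !rmorph1; ring.
Qed.

Lemma kummer_exp th u : F th = iota u ->
  (1 + psi (eta r) * th) ^+ p = iota (1 + f (eta r) ^+ p * u).
Proof.
move=> thu; rewrite (kummer_eval_exp p_prime xi_def) thu.
by rewrite (rmorphD iota) rmorph1 (rmorphM iota) !rmorphXn.
Qed.

Let psi_fixed : sigma (psi r) = psi r.
Proof. exact: (Cp_linear galS). Qed.

Let psi_sum : \sum_(i < p) psi r ^+ i = 0.
Proof. by under eq_bigr do rewrite -rmorphXn; rewrite -rmorph_sum rp rmorph0. Qed.

(** Elements congruent modulo [m S] have congruent [p]-th powers, and [m S] contracts to [m]. *)
Lemma extended_cong m b b' c c' : is_ideal m -> b ^+ p = iota c -> b' ^+ p = iota c' ->
  extended p iota sigma m (b - b') -> m c' -> m c.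
Proof.
move=> idm bc bc' /(is_ideal_congX (extended_ideal p iota sigma idm) p).
rewrite bc bc' -rmorphB => /(extendedE p_gt0 galS idm) mcc mc'.
by case: (idm) => _ mD _; rewrite -(subrK c' c); exact: mD.
Qed.

(* Adding to theta a multiple of y - alpha, alpha = 1 + eta theta, where
   sigma(y) = r y and y^p is not in m_j, moves alpha^p out of m_j; the multiple
   is taken in the m_i already dealt with, so that alpha^p stays out of those. *)
Lemma kummer_avoid n (m : 'I_n -> R -> Prop) k : exists th u,
  [/\ sigma th = psi r * th + 1, F th = iota u &
    forall i : 'I_n, (i < k)%N -> maximal_ideal (m i) ->
      ~ m i (1 + f (eta r) ^+ p * u)].
Proof.
elim: k => [|k [th [u [thE thu thm]]]].
  have [th thE] := affine_eigen p_gt0 galS psi_fixed psi_sum.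
  by have [u thu] := kummer_eval_fixed thE; exists th, u; split.
set w := 1 + _ in thm.
have [kn|nk] := ltnP k n; last first.
  exists th, u; split=> // i _; apply: thm; exact: leq_trans (ltn_ord i) nk.
pose j := Ordinal kn.
have jP (i : 'I_n) : (i < k.+1)%N -> (i < k)%N \/ i = j.
  by rewrite ltnS leq_eqVlt => /orP[/eqP ik|]; [right; exact: val_inj|left].
have [[maxj mjw]|good] := pselect (maximal_ideal (m j) /\ m j w); last first.
  exists th, u; split=> // i /jP[|->]; first exact: thm.
  by move=> maxj mjw; apply: good.
have [idj j1 _] := maxj; have [_ jD jM] := idj.
have [i ik maxi mij|e [nje mie]] := maximal_ideal_avoid (k := k) (m := m) maxj.
  by apply: (thm i ik maxi); apply/mij.
(* If [eta] were in [m j], then [w] would be congruent to 1 there, while [w] lies in [m j]. *)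
have njeta : ~ m j (f (eta r)).
  move=> jeta; apply: j1.
  have -> : 1 = w - f (eta r) ^+ p.-1 * u * f (eta r).
    have -> : w = 1 + f (eta r) ^+ p.-1.+1 * u by rewrite prednK.
    rewrite exprS; ring.
  by apply: is_idealB => //; exact: jM.
have [|d jd] := maximal_ideal_inv (a := f (eta r) * e) maxj.
  by case/(maximal_ideal_prime maxj).
have [y [c [yE yc njc]]] := eigen_avoid p_gt0 galS psi_fixed psi_sum maxj.
(* Since [y] and [al] are both eigenvectors for [r], [th'] solves the same equation as [th]. The new
   [1 + eta th'] is [al + eta e d (y - al)]: it is congruent to [al] modulo the earlier maximal
   [m i], which contain [e], and to [y] modulo [m j], where [eta e d] is 1. *)
pose al := 1 + psi (eta r) * th; pose th' := th + iota (e * d) * (y - al).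
have alE : sigma al = psi r * al by exact: kummer_eigen.
have th'E : sigma th' = psi r * th' + 1.
  rewrite rmorphD rmorphM rmorphB yE alE thE (Cp_linear galS) /th'; ring.
have [u' thu'] := kummer_eval_fixed th'E.
have al'E : 1 + psi (eta r) * th' = al + iota (f (eta r) * e * d) * (y - al).
  rewrite /th' /al !rmorphM /=; ring.
exists th', u'; split=> // i /jP[ik maxi m_w'|->{i} _ m_w'].
  apply: (thm i ik maxi); have [idi _ _] := maxi.
  apply: (extended_cong idi (kummer_exp thu) (kummer_exp thu') _ m_w').
  have [_ _ EM] := extended_ideal p iota sigma idi.
  have -> : 1 + psi (eta r) * th - (1 + psi (eta r) * th') =
      (iota (f (eta r) * d) * (al - y)) * iota e.
    by rewrite al'E -/al !rmorphM /=; ring.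
  by apply: EM; apply/extendedE => //; exact: mie.
apply: njc; apply: (extended_cong idj yc (kummer_exp thu') _ m_w').
have [_ _ EM] := extended_ideal p iota sigma idj.
have -> : y - (1 + psi (eta r) * th') = (y - al) * iota (1 - f (eta r) * e * d).
  by rewrite al'E rmorphB rmorph1; ring.
by apply: EM; apply/extendedE.
Qed.

Lemma kummer_generator : semilocal R -> exists th u,
  [/\ sigma th = psi r * th + 1, F th = iota u &
    exists v, (1 + f (eta r) ^+ p * u) * v = 1].
Proof.
case=> n [m mP]; have [th [u [thE thu thm]]] := kummer_avoid m n.
exists th, u; split=> //; apply: unit_of_maximal => I maxI.
have [i Ii] := mP I maxI.
have -> : I = m i by apply: funext => x; apply: propext.
apply: thm => //.
by have <- : I = m i by apply: funext => x; apply: propext.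
Qed.

End KummerGenerator.

(** * The power basis *)

Section PowerBasis.
Variables (p : nat) (R S : comPzRingType).
Variables (iota : {rmorphism R -> S}) (sigma : {rmorphism S -> S}).
Hypothesis p_prime : prime p.
Hypothesis galS : Cp_galois p iota sigma.
Variables (r th : S).
Hypothesis r_fix : sigma r = r.
Hypothesis rp : \sum_(i < p) r ^+ i = 0.
Hypothesis thE : sigma th = r * th + 1.
Hypothesis alpha_unit : exists v, (1 + (r - 1) * th) * v = 1.

Let p_gt0 : (0 < p)%N := prime_gt0 p_prime.

Lemma iter_affine_eigen k : iter k sigma th = r ^+ k * th + \sum_(i < k) r ^+ i.
Proof.
elim: k => [|k IH]; first by rewrite big_ord0 mul1r addr0.
rewrite iterS IH rmorphD rmorphM rmorphXn r_fix thE big_ord_recr /=.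
rewrite rmorph_sum (eq_bigr (fun i : 'I_k => r ^+ i)); last first.
  by move=> i _; rewrite rmorphXn /= r_fix.
rewrite exprSr; ring.
Qed.

(** The difference factors as [r ^+ i] times the geometric sum of length [j - i] times
    [1 + (r - 1) th]. The middle factor is a cyclotomic unit because [0 < j - i < p]. *)
Lemma conjugate_diff_unit i j : (i < j < p)%N ->
  exists v, (iter j sigma th - iter i sigma th) * v = 1.
Proof.
case/andP=> ij jp; have [v al_v] := alpha_unit.
have k0 : (0 < j - i)%N by rewrite subn_gt0.
have [|w qw] := cyclotomic_unit rp _ k0.
  rewrite coprime_sym prime_coprime // gtnNdvd //.
  exact: leq_ltn_trans (leq_subr _ _) jp.
have rV : r ^+ i * r ^+ (p - i) = 1.
  by rewrite -exprD subnKC ?(root_exp1 rp) // ltnW // (ltn_trans ij).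
exists (r ^+ (p - i) * w * v).
have -> : iter j sigma th - iter i sigma th =
    r ^+ i * (\sum_(l < j - i) r ^+ l) * (1 + (r - 1) * th).
  move: (subnKC (ltnW ij)); set k := (j - i)%N => <-.
  rewrite !iter_affine_eigen geometric_sumD exprD.
  have rk : r ^+ k = 1 + (r - 1) * \sum_(l < k) r ^+ l.
    by rewrite -subrX1 addrC subrK.
  rewrite rk; ring.
transitivity ((r ^+ i * r ^+ (p - i)) * ((\sum_(l < j - i) r ^+ l) * w) *
  ((1 + (r - 1) * th) * v)); first ring.
by rewrite rV qw al_v !mulr1.
Qed.

Let V : 'M[S]_p := Vandermonde p (\row_j iter j sigma th).

Lemma conjugate_det_unit : exists v, \det V * v = 1.
Proof.
rewrite det_Vandermonde; pose unit (x : S) := exists v, x * v = 1.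
have unitM x y : unit x -> unit y -> unit (x * y).
  by move=> [v xv] [w yw]; exists (v * w); rewrite mulrACA xv yw mulr1.
have unit1 : unit 1 by exists 1; rewrite mulr1.
apply: (big_ind unit) => // i _; apply: (big_ind unit) => // j ij.
by rewrite !mxE; apply: conjugate_diff_unit; rewrite ij ltn_ord.
Qed.

Lemma conjugate_matrix_inj (c : 'rV[S]_p) : c *m V = 0 -> c = 0.
Proof.
move=> /(congr1 (mulmx^~ (\adj V))); rewrite -mulmxA mul_mx_adj mul0mx.
rewrite mul_mx_scalar => dc; have [v dv] := conjugate_det_unit.
by rewrite -[c]scale1r -dv mulrC -scalerA dc scaler0.
Qed.

Lemma conjugate_matrixE (c : 'I_p -> S) j :
  ((\row_i c i) *m V) 0 j = \sum_i c i * iter j sigma th ^+ i.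
Proof. by rewrite mxE; apply: eq_bigr => i _; rewrite !mxE. Qed.

Lemma iter_power_sum (c : 'I_p -> R) j :
  iter j sigma (\sum_i iota (c i) * th ^+ i) =
  \sum_i iota (c i) * iter j sigma th ^+ i.
Proof.
rewrite rmorph_sum; apply: eq_bigr => i _.
by rewrite rmorphM rmorphXn /= (iter_linear galS).
Qed.

(** Applying all [sigma^j] to the relation gives a row vector killed by the invertible Vandermonde
    matrix. *)
Lemma power_basis_free (c : 'I_p -> R) :
  \sum_i iota (c i) * th ^+ i = 0 -> forall i, c i = 0.
Proof.
move=> c0 i; apply: (Cp_injective galS); rewrite rmorph0.
have /rowP/(_ i) : \row_i iota (c i) = 0.
  apply: conjugate_matrix_inj; apply/rowP => j.
  by rewrite conjugate_matrixE -iter_power_sum c0 rmorph0 mxE.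
by rewrite !mxE.
Qed.

(* By uniqueness, the solution c of c V = (sigma^j s)_j is fixed by sigma. *)
Lemma power_basis_span s : exists c : 'I_p -> R, s = \sum_i iota (c i) * th ^+ i.
Proof.
have [v dv] := conjugate_det_unit.
pose c : 'rV[S]_p := v *: ((\row_j iter j sigma s) *m \adj V).
have cV : c *m V = \row_j iter j sigma s.
  by rewrite -scalemxAl -mulmxA mul_adj_mx mul_mx_scalar scalerA mulrC dv scale1r.
have cE (j : 'I_p) : \sum_i c 0 i * iter j sigma th ^+ i = iter j sigma s.
  move/rowP/(_ j): cV; rewrite mxE [RHS]mxE => <-.
  by apply: eq_bigr => i _; rewrite !mxE.
have c_fixed i : sigma (c 0 i) = c 0 i.
  have /rowP/(_ i) : \row_i (sigma (c 0 i) - c 0 i) = 0.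
    apply: conjugate_matrix_inj; apply/rowP => j; rewrite conjugate_matrixE [RHS]mxE.
    under eq_bigr do rewrite mulrBl.
    rewrite sumrB cE; apply/eqP; rewrite subr_eq0; apply/eqP.
    (* [sigma] permutes the equations [cE] cyclically: the one at [j] comes from [j - 1], or from
       [p.-1] when [j = 0]. *)
    have pred_j : exists k : 'I_p, forall x, sigma (iter k sigma x) = iter j sigma x.
      case: j => -[|j] jp; last by exists (Ordinal (ltnW jp)).
      have pp : (p.-1 < p)%N by rewrite prednK.
      by exists (Ordinal pp) => x; rewrite -iterS prednK // (Cp_action galS).
    have [k kj] := pred_j.
    rewrite -(kj s) -cE rmorph_sum; apply: eq_bigr => l _.
    by rewrite rmorphM rmorphXn /= kj.
  by rewrite !mxE => /eqP; rewrite subr_eq0 => /eqP.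
have /choice[a aP] : forall i, exists a, c 0 i = iota a.
  by move=> i; apply: (Cp_fixed galS).
exists a; rewrite -[LHS](cE (Ordinal p_gt0)).
by apply: eq_bigr => i _; rewrite aP.
Qed.

End PowerBasis.

(** * Homomorphisms out of R and T *)

(** Evaluation at [th] kills [P], so a polynomial and its remainder modulo [P] have the same
    value. *)
Lemma qpoly_lift (B S : comNzRingType) (P : {poly B}) (h : {rmorphism B -> S})
    (th : S) : (1 < size P)%N -> P \is monic -> (map_poly h P).[th] = 0 ->
  exists psi : {rmorphism {poly %/ P} -> S},
    forall q, psi (in_qpoly P q) = (map_poly h q).[th].
Proof.
move=> sP mP Pth; pose ev : {rmorphism {poly B} -> S} :=
  horner_morph (fun x => mulrC th (h x)).
have ev_P : ev P = 0 by exact: Pth.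
have evP (q : {poly B}) : ev (in_qpoly P q) = ev q.
  rewrite /= /mk_monic sP mP /= [in RHS](Pdiv.RingMonic.rdivp_eq mP q).
  by rewrite rmorphD rmorphM ev_P mulr0 add0r.
pose psi (q : {poly %/ P}) := ev q.
have psiB : zmod_morphism psi by move=> x y; rewrite /psi -rmorphB.
have psiM : monoid_morphism psi.
  by split=> [|x y]; [exact: rmorph1|rewrite /psi [LHS]evP rmorphM].
pose psiBm := GRing.isZmodMorphism.Build _ _ psi psiB.
pose psiMm := GRing.isMonoidMorphism.Build _ _ psi psiM.
pose psim : {rmorphism {poly %/ P} -> S} := HB.pack psi psiBm psiMm.
by exists psim => q; exact: evP.
Qed.

Section Generic.
Variables (A : comNzRingType) (p : nat) (r xi : A).

(** Evaluate [u] first and then the formal inverse at [v]. A chosen representative differs from the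
    given polynomial by a multiple of [den *: 'X - 1], which this evaluation kills. *)
Lemma Rgen_lift (R : comNzRingType) (f : {rmorphism A -> R}) (u v : R) :
    (1 + f (eta r) ^+ p * u) * v = 1 ->
  exists h : {rmorphism Rgen p r -> R},
    (forall c, h (to_Rgen p r c) = f c) /\ h (Rgen_u p r) = u.
Proof.
move=> uv; pose ev1 : {rmorphism {poly A} -> R} := horner_morph (fun x => mulrC u (f x)).
pose ev2 : {rmorphism {poly {poly A}} -> R} :=
  horner_morph (fun x => mulrC v (ev1 x)).
have ev1C a : ev1 a%:P = f a by exact: horner_morphC.
have ev1X : ev1 'X = u by exact: horner_morphX.
have ev2C q : ev2 q%:P = ev1 q by exact: horner_morphC.
have ev2X : ev2 'X = v by exact: horner_morphX.
have ev_den : ev2 (den p r *: 'X - 1) = 0.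
  rewrite rmorphB rmorph1 -mul_polyC rmorphM ev2C ev2X.
  by rewrite /den rmorphD rmorph1 -mul_polyC rmorphM ev1C ev1X rmorphXn uv subrr.
pose h (x : Rgen p r) := ev2 (repr x).
have hE q : h (Rgen_pi p r q) = ev2 q.
  apply/eqP; rewrite -subr_eq0 -rmorphB.
  have : repr (Rgen_pi p r q) - q \in (loc_ideal p r : idealr {poly {poly A}}).
    by rewrite Quotient.idealrBE reprK.
  by case/asboolP => t ->; rewrite rmorphM ev_den mulr0.
have hpi x : exists q, x = Rgen_pi p r q by exists (repr x); rewrite /= reprK.
have hB : zmod_morphism h.
  by move=> x y; have [[a ->] [b ->]] := (hpi x, hpi y); rewrite -rmorphB !hE rmorphB.
have hM : monoid_morphism h.
  split=> [|x y]; first by rewrite -(rmorph1 (Rgen_pi p r)) hE rmorph1.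
  by have [[a ->] [b ->]] := (hpi x, hpi y); rewrite -rmorphM !hE rmorphM.
pose hBm := GRing.isZmodMorphism.Build _ _ h hB.
pose hMm := GRing.isMonoidMorphism.Build _ _ h hM.
pose hm : {rmorphism Rgen p r -> R} := HB.pack h hBm hMm.
exists hm; split=> [c|].
  by rewrite [LHS]hE ev2C ev1C.
by rewrite [LHS]hE ev2C ev1X.
Qed.

Hypothesis p_gt0 : (0 < p)%N.

Lemma to_TgenE c : to_Tgen p r xi c = in_qpoly _ c%:P :> Tgen p r xi.
Proof.
apply: val_inj; rewrite /= Pdiv.CommonRing.rmodp_small // size_polyC.
by rewrite (leq_ltn_trans (leq_b1 _)) // size_mk_monic_gt1.
Qed.

Lemma Tgen_lift (S : comNzRingType) (h : {rmorphism Rgen p r -> S}) (th : S) :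
    kummer_eval p r xi (h \o to_Rgen p r) th = h (Rgen_u p r) ->
  exists psi : {rmorphism Tgen p r xi -> S},
    forall q, psi (in_qpoly (Tpoly p r xi) q) = (map_poly h q).[th].
Proof.
move=> thE; apply: qpoly_lift; [by rewrite size_Tpoly|exact: Tpoly_monic|].
rewrite rmorphB rmorphD /= map_polyXn map_polyC /= -map_poly_comp.
by rewrite !hornerE_comm hornerXn -thE /kummer_eval subrr.
Qed.

(** The modulus is monic of degree [p], so representatives have degree below [p]. *)
Lemma Tgen_span (t : Tgen p r xi) : exists c : 'I_p -> Rgen p r,
  t = \sum_i to_Tgen p r xi (c i) * theta p r xi ^+ i.
Proof.
have size_t : (size (t : {poly %/ Tpoly p r xi}) <= p)%N.
  rewrite -ltnS; apply: leq_trans (size_mk_monic t) _.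
  by rewrite mk_monic_Tpoly // size_Tpoly.
have -> : t = in_qpoly (Tpoly p r xi) (t : {poly %/ Tpoly p r xi}).
  by apply: val_inj; rewrite /= Pdiv.CommonRing.rmodp_small // size_mk_monic.
move: (t : {poly _}) size_t => q size_q; exists (fun i => q`_i).
have {1}-> : q = \sum_(i < p) (q`_i)%:P * 'X^i.
  under eq_bigr do rewrite mul_polyC.
  rewrite -(poly_def p (fun i => q`_i)); apply/polyP => i; rewrite coef_poly.
  by case: ltnP => // pi; rewrite nth_default // (leq_trans size_q).
rewrite rmorph_sum; apply: eq_bigr => i _.
by rewrite rmorphM rmorphXn /= to_TgenE.
Qed.

End Generic.

(** * The tensor product *)

Section TensorIso.
Variables (R A B S : comPzRingType).
Variables (alpha : {rmorphism R -> A}) (beta : {rmorphism R -> B}).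
Variables (psi : {rmorphism A -> S}) (iota : {rmorphism B -> S}).
Hypothesis psi_alpha : forall c, psi (alpha c) = iota (beta c).
Variables (n : nat) (e : 'I_n -> A).
Hypothesis A_span : forall a, exists c, a = \sum_i alpha (c i) * e i.
Hypothesis S_free : forall c : 'I_n -> B,
  \sum_i iota (c i) * psi (e i) = 0 -> forall i, c i = 0.
Hypothesis S_span : forall s, exists c : 'I_n -> B, s = \sum_i iota (c i) * psi (e i).
Variables (g : A -> A) (sigma : {rmorphism S -> S}).
Hypothesis sigma_iota : forall b, sigma (iota b) = iota b.
Hypothesis psi_g : forall a, psi (g a) = sigma (psi a).

Local Notation tpure := (tensor_pure alpha beta).

Lemma tensor_pureD x y y' : tpure x (y + y') = tpure x y + tpure x y'.
Proof. by case: (tensor_balanced alpha beta). Qed.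

Lemma tensor_pure0 x : tpure x 0 = 0.
Proof. by apply: (addrI (tpure x 0)); rewrite -tensor_pureD !addr0. Qed.

Lemma tensor_pure11 : tpure 1 1 = 1.
Proof. by []. Qed.

Lemma tensor_pure_sum (I : Type) (s : seq I) (F : I -> A) y :
  tpure (\sum_(i <- s) F i) y = \sum_(i <- s) tpure (F i) y.
Proof.
have [D _ _] := tensor_balanced alpha beta.
have D0 : tpure 0 y = 0 by apply: (addrI (tpure 0 y)); rewrite -D !addr0.
by elim/big_rec2: _ => // i y1 y2 _ <-; rewrite D.
Qed.

Lemma tensor_basis_span (w : tensor alpha beta) :
  exists c : 'I_n -> B, w = \sum_i tpure (e i) (c i).
Proof.
rewrite (tensor_span w); elim: (repr w) => [|[a b] s [c IH]].
  by exists (fun=> 0); rewrite big_nil big1 // => i _; rewrite tensor_pure0.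
have [d aE] := A_span a; exists (fun i => beta (d i) * b + c i).
rewrite big_cons IH /= aE tensor_pure_sum -big_split; apply: eq_bigr => i _.
have [_ _ Z] := tensor_balanced alpha beta.
by rewrite /= tensor_pureD Z.
Qed.

(** The universal property gives [Psi], sending [a] tensor [b] to [psi a * iota b]. It carries the
    generators [e i] tensor 1 over [B] to a basis of [S], so it is bijective; the isomorphism asked
    for is its inverse [Phi]. *)
Lemma tensor_isomorphic :
  Cp_isomorphic iota sigma (tensor_inr alpha beta) (tensor_mapl alpha beta g).
Proof.
have [|Psi PsiE] := @tensor_lift _ _ _ alpha beta S (fun a b => psi a * iota b).
  split=> [x x' y|x y y'|r x y]; first by rewrite rmorphD mulrDl.
    by rewrite rmorphD mulrDr.
  by rewrite !rmorphM psi_alpha; ring.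
have PsiM : {morph Psi : w w' / w * w'}.
  move=> w w'; rewrite (tensor_span w) (tensor_span w') mulr_suml !raddf_sum mulr_suml.
  apply: eq_bigr => z _; rewrite !mulr_sumr raddf_sum; apply: eq_bigr => z' _.
  by rewrite tensor_pureM !PsiE !rmorphM mulrACA.
have PsiE1 (c : 'I_n -> B) :
    Psi (\sum_i tpure (e i) (c i)) = \sum_i iota (c i) * psi (e i).
  by rewrite raddf_sum; apply: eq_bigr => i _; rewrite PsiE mulrC.
have Psi_inj : injective Psi.
  move=> w w' /eqP; rewrite -subr_eq0 -raddfB => /eqP Pw.
  apply/eqP; rewrite -subr_eq0; apply/eqP; have [c wE] := tensor_basis_span (w - w').
  move: Pw; rewrite wE PsiE1 => /S_free c0.
  by apply: big1 => i _; rewrite c0 tensor_pure0.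
have /choice[Phi PhiE] s : exists w, Psi w = s.
  by have [c ->] := S_span s; exists (\sum_i tpure (e i) (c i)).
have PhiB : zmod_morphism Phi.
  by move=> x y; apply: Psi_inj; rewrite raddfB !PhiE.
have PhiM : monoid_morphism Phi.
  split=> [|x y]; apply: Psi_inj; rewrite ?PsiM !PhiE //.
  by rewrite -tensor_pure11 PsiE !rmorph1 mulr1.
pose PhiBm := GRing.isZmodMorphism.Build _ _ Phi PhiB.
pose PhiMm := GRing.isMonoidMorphism.Build _ _ Phi PhiM.
pose Phim : {rmorphism S -> tensor alpha beta} := HB.pack Phi PhiBm PhiMm.
exists Phim; split=> [|b|s]; rewrite /Phim /=.
- by exists Psi => // w; apply: Psi_inj; rewrite PhiE.
- by apply: Psi_inj; rewrite PhiE PsiE rmorph1 mul1r.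
(* Equivariance is checked in [S], on the very representative of [Phi s] from which [tensor_mapl] is
   computed. *)
apply: Psi_inj; rewrite PhiE /tensor_mapl raddf_sum -{1}(PhiE s).
rewrite {1}(tensor_span (Phi s)) raddf_sum rmorph_sum; apply: eq_bigr => z _.
by rewrite !PsiE rmorphM sigma_iota psi_g.
Qed.

(** Over the zero ring both [S] and the tensor product vanish. This case is separate because the
    Kummer polynomial is evaluated in nonzero rings. *)
Lemma trivial_tensor_isomorphic : (1 : B) = 0 ->
  Cp_isomorphic iota sigma (tensor_inr alpha beta) (tensor_mapl alpha beta g).
Proof.
move=> B10; have S0 (x y : S) : x = y.
  by rewrite -[x]mul1r -[y]mul1r -(rmorph1 iota) B10 rmorph0 !mul0r.
have T0 (x y : tensor alpha beta) : x = y.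
  rewrite -[x]mul1r -[y]mul1r -tensor_pure11.
  by rewrite B10 tensor_pure0 !mul0r.
pose Phi (s : S) : tensor alpha beta := 0.
have PhiB : zmod_morphism Phi by move=> x y; rewrite /Phi subr0.
have PhiM : monoid_morphism Phi.
  by split=> [|x y]; [exact: T0|rewrite /Phi mul0r].
pose PhiBm := GRing.isZmodMorphism.Build _ _ Phi PhiB.
pose PhiMm := GRing.isMonoidMorphism.Build _ _ Phi PhiM.
pose Phim : {rmorphism S -> tensor alpha beta} := HB.pack Phi PhiBm PhiMm.
exists Phim; split=> [|b|s]; try exact: T0.
by exists (fun=> 0) => x; [exact: S0|exact: T0].
Qed.

End TensorIso.

(** * Assembly, first over nonzero rings and then in general *)

(** An equality of structures rather than an isomorphism, so that substitution carries the morphisms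
    and the Galois hypothesis along. Repacking only adds a proof of [1 <> 0], and forgetting it
    returns the original record. *)
Lemma comNzRing_of (R : comPzRingType) : (1 : R) <> 0 ->
  exists R0 : comNzRingType, R = R0.
Proof.
case: R => R c; pose R1 : comPzRingType := GRing.ComPzRing.Pack c.
move=> /(introN eqP) nz.
pose nzm := GRing.PzSemiRing_isNonZero.Build R1 nz.
pose R0 : comNzRingType := HB.pack R (GRing.ComPzRing.on R1) nzm.
exists R0; rewrite /R0 /nzm /R1 {nzm R0}; move: nz; rewrite /R1 {R1}.
by case: c.
Qed.

Lemma generic_extension_nz (A : comNzRingType) (p : nat) (r xi : A)
    (p_prime : prime p) (rp : \sum_(i < p) r ^+ i = 0)
    (eta_reg : GRing.lreg (eta r)) (xi_def : p%:R = xi * eta r ^+ p.-1)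
    (R S : comNzRingType) (R_semilocal : semilocal R) (f : {rmorphism A -> R})
    (iota : {rmorphism R -> S}) (sigma : {rmorphism S -> S})
    (galS : Cp_galois p iota sigma) :
  exists h : {rmorphism Rgen p r -> R},
    (forall c, h (to_Rgen p r c) = f c) /\
    Cp_isomorphic iota sigma (tensor_inr (to_Tgen p r xi) h)
      (tensor_mapl (to_Tgen p r xi) h (Tsigma p r xi)).
Proof.
have p_gt0 := prime_gt0 p_prime.
have [th [u [thE thu [v uv]]]] :=
  kummer_generator p_prime rp eta_reg xi_def f galS R_semilocal.
have [h [hf hu]] := Rgen_lift uv.
exists h; split=> //.
have [|psi psiE] := @Tgen_lift _ p r xi p_gt0 S (iota \o h) th.
  rewrite /= hu -thu /kummer_eval; congr (_ + _.[_]).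
  by apply: eq_map_poly => c /=; rewrite hf.
have psiC c : psi (to_Tgen p r xi c) = iota (h c).
  by rewrite to_TgenE psiE map_polyC hornerC.
have psi_th : psi (theta p r xi) = th by rewrite psiE map_polyX hornerX.
have rE : sigma (iota (f r)) = iota (f r) by exact: (Cp_linear galS).
have rpE : \sum_(i < p) iota (f r) ^+ i = 0.
  under eq_bigr do rewrite -!rmorphXn.
  by rewrite -!rmorph_sum rp !rmorph0.
(* The [p]-th power of [1 + eta th] is the image of the unit [1 + eta ^+ p * u]. *)
have alpha_unit : exists v, (1 + (iota (f r) - 1) * th) * v = 1.
  have etaE : (iota \o f) (eta r) = iota (f r) - 1 by rewrite /= !rmorphB !rmorph1.
  have := kummer_exp p_prime xi_def thu; rewrite etaE -{1}(prednK p_gt0) exprS => al.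
  exists ((1 + (iota (f r) - 1) * th) ^+ p.-1 * iota v).
  by rewrite mulrA al -rmorphM uv rmorph1.
have psi_sum (c : 'I_p -> R) : \sum_i iota (c i) * psi (theta p r xi ^+ i) =
    \sum_i iota (c i) * th ^+ i.
  by apply: eq_bigr => i _; rewrite rmorphXn psi_th.
apply: (@tensor_isomorphic _ _ _ _ _ _ psi _ _ p (fun i => theta p r xi ^+ i)).
- exact: psiC.
- exact: Tgen_span.
- move=> c; rewrite psi_sum; exact: (power_basis_free p_prime galS rE rpE thE).
- move=> s; have [c ->] := power_basis_span p_prime galS rE rpE thE alpha_unit s.
  by exists c; rewrite psi_sum.
- exact: (Cp_linear galS).
(* [psi] sends [r theta + 1] to [sigma th], and [sigma] fixes the coefficients, so both sides are
   the representative of [t] evaluated at [sigma th]. *)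
move=> t; rewrite /Tsigma -horner_map /= rmorphD rmorphM rmorph1 psi_th !psiC /= hf.
rewrite -thE -map_poly_comp.
have {2}-> : t = in_qpoly (Tpoly p r xi) (t : {poly %/ Tpoly p r xi}).
  by apply: val_inj; rewrite /= Pdiv.CommonRing.rmodp_small // size_mk_monic.
rewrite psiE -horner_map -map_poly_comp; congr _.[_]; apply: eq_map_poly => c.
by rewrite /= psiC (Cp_linear galS).
Qed.

Theorem theorem1p4 (p : nat) (p_prime : prime p)
    (xi : Zrho p) (xi_unit : exists v : Zrho p, xi * v = 1)
    (xi_def : p%:R = xi * eta (rho p) ^+ p.-1)
    (R' : comPzRingType) (R'_semilocal : semilocal R')
    (f : {rmorphism Zrho p -> R'})
    (S' : comPzRingType) (iota : {rmorphism R' -> S'})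
    (sigma : {rmorphism S' -> S'}) (S'_galois : Cp_galois p iota sigma) :
  exists h : {rmorphism Rgen p (rho p) -> R'},
    (forall c, h (to_Rgen p (rho p) c) = f c) /\
    Cp_isomorphic iota sigma
      (tensor_inr (to_Tgen p (rho p) xi) h)
      (tensor_mapl (to_Tgen p (rho p) xi) h (Tsigma p (rho p) xi)).
Proof.
(* If [R'] is zero, the zero map is a ring morphism and serves as [h]; otherwise [S'] is nonzero
   too, by injectivity of [iota]. *)
have [R10|R1] := pselect ((1 : R') = 0).
  have R0 (x y : R') : x = y by rewrite -[x]mul1r -[y]mul1r R10 !mul0r.
  pose h (x : Rgen p (rho p)) : R' := 0.
  have hB : zmod_morphism h by move=> x y; rewrite /h subr0.
  have hM : monoid_morphism h by split=> [|x y]; [rewrite R10|rewrite /h mul0r].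
  pose hBm := GRing.isZmodMorphism.Build _ _ h hB.
  pose hMm := GRing.isMonoidMorphism.Build _ _ h hM.
  pose hm : {rmorphism Rgen p (rho p) -> R'} := HB.pack h hBm hMm.
  by exists hm; split=> [c|]; [exact: R0|exact: trivial_tensor_isomorphic].
have S1 : (1 : S') <> 0.
  by rewrite -(rmorph1 iota) -(rmorph0 iota) => /(Cp_injective S'_galois).
have [Rn RE] := comNzRing_of R1; have [Sn SE] := comNzRing_of S1.
subst R' S'.
exact: (generic_extension_nz p_prime (rho_sum p_prime)
  (eta_lreg p_prime xi_def) xi_def R'_semilocal f S'_galois).
Qed.
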